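(* Let $\mathbb F_q$ be a finite field with $q$ elements, let $n\ge 2$, let $a_1,\dots,a_n,b\in\mathbb F_q^*$, and let $m_1,\dots,m_n,k,k_1,\dots,k_n$ be positive integers. Put $M=\operatorname{lcm}[m_1,\dots,m_n]$ and $d_j=\gcd(m_j,q-1)$ for $j=1,\dots,n$. Let $0\le t\le n$ and assume (after indexing) that $d_1,\dots,d_t$ are odd, $d_{t+1},\dots,d_n$ are even, and $d_1,\dots,d_t,d_{t+1}/2,\dots,d_n/2$ are pairwise coprime. Assume also that $$\gcd\Bigl(\sum_{j=1}^n \frac{k_jM}{m_j}-kM,\;q-1\Bigr)=1.$$ Then the number of $(x_1,\dots,x_n)\in\mathbb F_q^n$ satisfying $(a_1x_1^{m_1}+\dots+a_nx_n^{m_n})^k=bx_1^{k_1}\cdots x_n^{k_n}$ equals $$q^{n-1}+(-1)^{n-1}+(-1)^{n-1}\sum_{j=1}^{\lfloor (n-t)/2\rfloor}\eta((-1)^j)\,\sigma_{2j}\bigl(\eta(a_{t+1}),\dots,\eta(a_n)\bigr)\,q^j+E,$$ where $E=\eta((-1)^{n/2}a_1\cdots a_n)\,q^{(n-2)/2}(q-1)$ if $t=0$ and $n$ is even, and $E=0$ otherwise.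
   Context: $\sigma_{2j}(z_1,\dots,z_{n-t})$ denotes the elementary symmetric polynomial of degree $2j$ in $n-t$ variables. $\eta$ is the quadratic character on $\mathbb F_q$: $\eta(x)=+1,-1,0$ according as $x$ is a nonzero square, a non-square, or zero in $\mathbb F_q$. (If $q$ is even then every $d_j$ is odd, so $t=n$ and all terms involving $\eta$ are absent.) $\mathbb F_q^*=\mathbb F_q\setminus\{0\}$. *)

(* Defs.v *)
From HB Require Import structures.
From mathcomp Require Import all_boot all_order all_algebra all_field.
Set Implicit Arguments. Unset Strict Implicit. Unset Printing Implicit Defensive.
Import Order.TTheory GRing.Theory Num.Theory.
Local Open Scope ring_scope.

Definition qeta (F : finFieldType) (x : F) : int :=
  if x == 0 then 0
  else if [exists y : F, y ^+ 2 == x] then 1 else -1.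

Definition esym_at (n : nat) (P : {pred 'I_n}) (f : 'I_n -> int) (r : nat) : int :=
  \sum_(I : {set 'I_n} | (I \subset P) && (#|I| == r)) \prod_(i in I) f i.

(* Main.v *)
Require Import Defs.
From HB Require Import structures.
From mathcomp Require Import all_boot all_order all_algebra all_field.
From mathcomp Require Import ring.
Import Order.TTheory GRing.Theory Num.Theory.

Set Implicit Arguments.
Unset Strict Implicit.
Unset Printing Implicit Defensive.

Local Open Scope ring_scope.

(** Write S for the diagonal form and q for #|F|.  At a point with a vanishing
coordinate the equation reads S(x) = 0.  On the torus (F^x)^n a unit u acts by
x_i |-> u^(M/m_i) x_i and multiplies the ratio of the two sides by a power of u
whose exponent is prime to q - 1, so the solutions in the torus are one
(q - 1)-th of the points with S(x) nonzero.  It remains to count the zeros of S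
in F^n and in the torus.

Both counts are values, at c = 1 and at c = 0, of the number of zeros of S
weighted by c^(number of vanishing coordinates).  This is the coefficient at 0
of the product over i of c + sum_(x != 0) [a_i x^(m_i)] in the group ring Z[F].
Multiplying S by prod_i y_i^(s_i) does not change its zeros; averaging over the
units y_i replaces each m_i by its gcd with s_i, and suitable s_i leave only the
exponents 1 and 2.  With U = sum_v [v] and H = sum_v eta(v) [v], the factors
become U + (c - 1) and U + (c - 1) + eta(a_i) H.  The product is then expanded
using U^2 = q U, U H = 0 and H^2 = eta(-1) (q - U). *)

(** * The integral group ring of a finite abelian group *)

Section IntegralGroupRing.
Variable G : finZmodType.

Definition group_ring : Type := {ffun G -> int}.
HB.instance Definition _ := GRing.Zmodule.on group_ring.

Implicit Types (f g h : group_ring) (u v w : G).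

Definition dirac u : group_ring := [ffun v => (v == u)%:R].
Definition convolution f g : group_ring := [ffun v => \sum_w f w * g (v - w)].

Fact convolutionA : associative convolution.
Proof.
move=> f g h; apply/ffunP => v; rewrite !ffunE.
under eq_bigr do rewrite ffunE mulr_sumr.
under [RHS]eq_bigr do rewrite ffunE mulr_suml.
rewrite [RHS]exchange_big; apply: eq_bigr => u _ /=.
rewrite [RHS](reindex_inj (addIr u)); apply: eq_bigr => w _ /=.
by rewrite addrK mulrA opprD addrA addrAC.
Qed.

Fact convolutionC : commutative convolution.
Proof.
move=> f g; apply/ffunP => v; rewrite !ffunE (reindex_inj (subrI v)).
by apply: eq_bigr => w _; rewrite subKr mulrC.
Qed.

Fact convolution_dirac u f v : convolution (dirac u) f v = f (v - u).
Proof.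
rewrite ffunE (bigD1 u) //= ffunE eqxx mul1r big1 ?addr0 // => w /negPf wu.
by rewrite ffunE wu mul0r.
Qed.

Fact convolution1f : left_id (dirac 0) convolution.
Proof. by move=> f; apply/ffunP => v; rewrite convolution_dirac subr0. Qed.

Fact convolutionDl : left_distributive convolution +%R.
Proof.
move=> f g h; apply/ffunP => v; rewrite !ffunE -big_split.
by apply: eq_bigr => w _; rewrite ffunE mulrDl.
Qed.

Fact dirac0_neq0 : dirac 0 != 0.
Proof. by apply/eqP => /ffunP/(_ 0); rewrite !ffunE eqxx. Qed.

HB.instance Definition _ := GRing.Zmodule_isComNzRing.Build group_ring
  convolutionA convolutionC convolution1f convolutionDl dirac0_neq0.

Lemma group_ring1 : 1 = dirac 0. Proof. by []. Qed.

Lemma diracD u v : dirac (u + v) = dirac u * dirac v.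
Proof.
by apply/ffunP => w; rewrite [RHS]convolution_dirac !ffunE subr_eq addrC.
Qed.

Lemma dirac_sum (I : finType) (u : I -> G) :
  dirac (\sum_i u i) = \prod_i dirac (u i).
Proof. exact: (big_morph dirac diracD group_ring1). Qed.

Lemma group_ringMnE f n v : (f *+ n) v = f v *+ n.
Proof. exact: ffunMnE. Qed.

Lemma natr_group_ringE n f v : (n%:R * f) v = n%:R * f v.
Proof. by rewrite !mulr_natl group_ringMnE. Qed.

Lemma intr_group_ringE (c : int) f v : (c%:~R * f) v = c * f v.
Proof.
case: c => n; first by rewrite -pmulrn natr_group_ringE natz.
by rewrite NegzE mulrNz !mulNr ffunE -pmulrn natr_group_ringE natz.
Qed.

Lemma group_ring_mulIn n : (0 < n)%N -> injective (fun f => f *+ n).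
Proof.
move=> n_gt0 f g fg; apply/ffunP => v; have /ffunP/(_ v) := fg.
by rewrite !group_ringMnE; apply: pmulrnI.
Qed.

Definition uniform : group_ring := [ffun=> 1].
Definition augmentation f : int := \sum_v f v.

Lemma uniformE : uniform = \sum_v dirac v.
Proof.
apply/ffunP => v; rewrite sum_ffunE ffunE (bigD1 v) //= ffunE eqxx.
by rewrite big1 ?addr0 // => w /negPf wv; rewrite ffunE eq_sym wv.
Qed.

Lemma mul_uniform f : uniform * f = (augmentation f)%:~R * uniform.
Proof.
apply/ffunP => v; rewrite intr_group_ringE [LHS]ffunE ffunE mulr1.
rewrite /augmentation [RHS](reindex_inj (subrI v)).
by apply: eq_bigr => w _; rewrite ffunE mul1r.
Qed.

Lemma augmentation_uniform : augmentation uniform = #|G|%:R.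
Proof.
rewrite /augmentation (eq_bigr (fun=> 1)) ?sumr_const // => v _.
by rewrite ffunE.
Qed.

Lemma prod_uniformD (I : Type) (r : seq I) (f : I -> group_ring)
    (e : I -> int) :
  (forall i, uniform * f i = (e i)%:~R * uniform) ->
  #|G|%:R * \prod_(i <- r) (uniform + f i)
  = #|G|%:R * \prod_(i <- r) f i
    + (\prod_(i <- r) (#|G|%:R + e i) - \prod_(i <- r) e i)%:~R * uniform.
Proof.
move=> uniform_f.
have uniform_prod s : uniform * \prod_(i <- s) f i
    = (\prod_(i <- s) e i)%:~R * uniform.
  elim: s => [|i s IH]; first by rewrite !big_nil mulrC.
  by rewrite !big_cons mulrA uniform_f -mulrA IH; ring.
elim: r => [|i r IH]; first by rewrite !big_nil; ring.
rewrite !big_cons mulrCA IH mulrDr mulrDl.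
rewrite [uniform * (_ * _)]mulrCA uniform_prod.
rewrite [(uniform + f i) * _]mulrCA mulrDl mul_uniform augmentation_uniform.
by rewrite [f i * uniform]mulrC uniform_f; ring.
Qed.

End IntegralGroupRing.

Arguments uniform {G}.

(** * Subset expansions and parity *)

Lemma prod_affine (R : comNzRingType) (I : finType) (f : I -> R) (x c : R) :
  \prod_i (f i * x + c)
  = \sum_(J : {set I}) c ^+ #|~: J| * \prod_(i in J) f i * x ^+ #|J|.
Proof.
rewrite bigA_distr; apply: eq_bigr => J _.
rewrite (bigID (mem J)) /= mulrC -mulrA; congr (_ * _).
  by rewrite -prodr_const; apply: eq_big => [i|i /negPf ->] //; rewrite inE.
by rewrite -prodr_const -big_split; apply: eq_bigr => i ->.
Qed.

Definition even_esym (R : comNzRingType) (I : finType) (P : {pred I})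
    (f : I -> R) (c y : R) : R :=
  \sum_(J : {set I} | (J \subset P) && ~~ odd #|J|)
    c ^+ #|~: J| * \prod_(i in J) f i * y ^+ #|J|./2.

Lemma even_esym0 (R : comNzRingType) (I : finType) (P : {pred I})
    (f : I -> R) (y : R) :
  even_esym P f 0 y
  = if ([set: I] \subset P) && ~~ odd #|I|
    then \prod_i f i * y ^+ #|I|./2 else 0.
Proof.
rewrite /even_esym big_mkcond (bigD1 setT) //=.
rewrite [X in _ + X]big1 ?addr0 => [|J JT].
  rewrite cardsT setCT cards0 expr0 mul1r; case: ifP => // _; congr (_ * _).
  by apply: eq_bigl => i; rewrite inE.
rewrite expr0n cards_eq0 -[set0]setCT (inj_eq (@setC_inj I)) (negPf JT).
by rewrite !mul0r if_same.
Qed.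

Lemma esym_at0 n (P : {pred 'I_n}) (f : 'I_n -> int) : esym_at P f 0 = 1.
Proof.
rewrite /esym_at (big_pred1 set0) ?big_set0 // => I /=.
by rewrite cards_eq0 andb_idl // => /eqP ->; apply/subsetP => i; rewrite inE.
Qed.

Lemma even_esymN1 n (P : {pred 'I_n}) (f : 'I_n -> int) (y : int) :
  even_esym P f (-1) y
  = (-1) ^+ n
    * (1 + \sum_(1 <= j < (#|P|)./2.+1) esym_at P f (2 * j) * y ^+ j).
Proof.
transitivity
  ((-1) ^+ n * \sum_(0 <= j < (#|P|)./2.+1) esym_at P f (2 * j) * y ^+ j).
  rewrite big_mkord mulr_sumr /even_esym.
  pose half_card (J : {set 'I_n}) : 'I_(#|P|./2).+1 := inord #|J|./2.
  rewrite (partition_big half_card xpredT) //=.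
  apply: eq_bigr => j _; rewrite mulr_suml mulr_sumr.
  have even_cardE (J : {set 'I_n}) :
      (J \subset P) && ~~ odd #|J| && (half_card J == j)
      = (J \subset P) && (#|J| == 2 * j)%N.
    have [JP|//] := boolP (J \subset P).
    have lt_half : (#|J|./2 < #|P|./2.+1)%N.
      by rewrite ltnS half_leq ?subset_leq_card.
    rewrite -val_eqE /= inordK // mul2n.
    apply/andP/eqP => [[/even_halfK cardJ /eqP <-]|->]; first by rewrite cardJ.
    by rewrite odd_double doubleK.
  rewrite (eq_bigl _ _ even_cardE); apply: eq_bigr => J /andP[_ /eqP cardJ].
  have -> : (-1) ^+ #|~: J| = (-1) ^+ n :> int.
    rewrite -[in RHS](card_ord n) -(cardsC J) exprD cardJ exprM sqrrN expr1n.
    by rewrite mul1r.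
  by rewrite cardJ mul2n doubleK mulrA.
by rewrite big_ltn // muln0 esym_at0 mulr1.
Qed.

Definition odd_or_half d := if odd d then d else d./2.

Lemma odd_or_halfE d : d = ((if odd d then 1 else 2) * odd_or_half d)%N.
Proof.
rewrite /odd_or_half; case: ifPn => [_|d_even]; first by rewrite mul1n.
by rewrite mul2n even_halfK.
Qed.

Lemma gcdn_double d e : coprime (odd_or_half d) e ->
  gcdn d (2 * e) = (if odd d then 1 else 2)%N.
Proof.
rewrite /odd_or_half; case: ifPn => [d_odd|d_even] coprime_de.
  by apply/eqP; rewrite -/(coprime _ _) coprimeMr coprimen2 d_odd.
by rewrite -[d]even_halfK // -mul2n -muln_gcdr (eqP coprime_de) muln1.
Qed.

(** * Finite fields and the quadratic character *)

Section FiniteField.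
Variable F : finFieldType.
Implicit Types (x y u v : F) (c : int).

Lemma expf_card_pred x : x != 0 -> x ^+ #|F|.-1 = 1.
Proof.
move=> x0; apply: (mulfI x0).
by rewrite -exprS mulr1 prednK ?expf_card // ltnW // finNzRing_gt1.
Qed.

Lemma card_units_gt0 : (0 < #|F|.-1)%N.
Proof. by rewrite -subn1 subn_gt0 finNzRing_gt1. Qed.

Lemma natr_card_pred (R : pzRingType) : #|F|.-1%:R = #|F|%:R - 1 :> R.
Proof. by rewrite -subn1 natrB // ltnW // finNzRing_gt1. Qed.

Lemma even_gcd_odd_card n : ~~ odd (gcdn n #|F|.-1) -> odd #|F|.
Proof.
apply: contraR => evenF; apply: dvdn_odd (dvdn_gcdr _ _) _.
by rewrite -[odd _]negbK -oddS prednK // ltnW // finNzRing_gt1.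
Qed.

Lemma sumr_const_units (V : nmodType) (w : V) :
  \sum_(x : F | x != 0) w = w *+ #|F|.-1.
Proof.
by rewrite sumr_const -(cardC1 (0 : F)); congr (_ *+ _); apply: eq_card.
Qed.

(* Euclid's algorithm on the exponents: substituting [y / x ^+ (d %/ s)] for
   [y] replaces [d] by [d %% s]. *)
Lemma sum_units_expr_gcd (V : nmodType) (f : F -> V) d s :
  \sum_(x | x != 0) \sum_(y | y != 0) f (x ^+ d * y ^+ s)
  = (\sum_(x | x != 0) f (x ^+ gcdn d s)) *+ #|F|.-1.
Proof.
elim/ltn_ind: s d => -[|s] IH d.
  rewrite gcdn0 -sumrMnl; apply: eq_bigr => x _.
  by rewrite -sumr_const_units; apply: eq_bigr => y _; rewrite expr0 mulr1.
rewrite -gcdn_modl gcdnC -(IH (d %% s.+1)%N) ?ltn_mod // exchange_big /=.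
rewrite exchange_big [RHS]exchange_big; apply: eq_bigr => x x0 /=.
have unit_x : x ^+ (d %/ s.+1) != 0 by rewrite expf_neq0.
rewrite [RHS](reindex_inj (mulfI unit_x)) /=.
apply: eq_big => y; first by rewrite mulf_eq0 (negPf unit_x).
move=> _; congr f; rewrite exprMn -exprM mulrAC -exprD.
by rewrite -divn_eq.
Qed.

Lemma odd_card_two_neq0 : odd #|F| -> 2%:R != 0 :> F.
Proof.
apply: contraTneq => two0.
have char2 : 2 \in [pchar F]%R by rewrite inE /= two0 eqxx.
have := finNzRing_gt1 F; have := card_pprimeChar char2.
by case: logn => [|n] ->; rewrite ?expn0 ?expnS ?oddM.
Qed.

Lemma qeta0 : qeta (0 : F) = 0.
Proof. by rewrite /qeta eqxx. Qed.

Lemma qeta_sqr y : y != 0 -> qeta (y ^+ 2) = 1.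
Proof.
move=> y0; rewrite /qeta expf_eq0 (negPf y0) /=.
by case: existsP => // -[]; exists y.
Qed.

Variant qeta_spec x : int -> Prop :=
  | QetaZero of x = 0 : qeta_spec x 0
  | QetaSquare y of y != 0 & x = y ^+ 2 : qeta_spec x 1
  | QetaNonSquare of x != 0 & (forall y, y ^+ 2 != x) : qeta_spec x (-1).

Lemma qetaP x : qeta_spec x (qeta x).
Proof.
rewrite /qeta; case: eqVneq => [->|x0]; first exact: QetaZero.
case: existsP => [[y /eqP xE]|nosqrt].
  apply: (QetaSquare (y := y)) => //; apply: contraNneq x0 => y0.
  by rewrite -xE y0 expr0n.
apply: QetaNonSquare => // y; apply/eqP => yx.
by apply: nosqrt; exists y; rewrite yx.
Qed.

Lemma qeta_mul_sqr y x : y != 0 -> qeta (y ^+ 2 * x) = qeta x.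
Proof.
move=> y0; have y2_neq0 : y ^+ 2 != 0 by rewrite expf_neq0.
case: (qetaP x) => [->|w w0 ->|x0 nosqrt]; first by rewrite mulr0 qeta0.
  by rewrite -exprMn qeta_sqr // mulf_neq0.
case: qetaP => // [/eqP|w _ yxE].
  by rewrite mulf_eq0 (negPf y2_neq0) (negPf x0).
have /eqP[] := nosqrt (w / y).
by rewrite expr_div_n -yxE mulrC mulKf.
Qed.

Lemma qetaV x : qeta x^-1 = qeta x.
Proof.
have [->|x0] := eqVneq x 0; first by rewrite invr0.
by rewrite -(qeta_mul_sqr x^-1 x0) expr2 mulfK.
Qed.

Lemma qeta_mulss x : x != 0 -> qeta x * qeta x = 1.
Proof. by case: qetaP => // ->; rewrite eqxx. Qed.

Lemma card_square_roots v : odd #|F| ->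
  #|[set x : F | x ^+ 2 == v]|%:Z = 1 + qeta v.
Proof.
move=> /odd_card_two_neq0 two0.
case: qetaP => [->|y y0 ->|v0 nosqrt].
- rewrite [X in #|pred_of_set X|](_ : _ = [set 0]) ?cards1 //.
  by apply/setP => x; rewrite !inE expf_eq0.
- rewrite [X in #|pred_of_set X|](_ : _ = [set y; - y]).
    rewrite cards2 (_ : y != - y) //.
    by rewrite -addr_eq0 -mulr2n -mulr_natl mulf_neq0.
  by apply/setP => x; rewrite !inE eqf_sqr.
- rewrite [X in #|pred_of_set X|](_ : _ = set0) ?cards0 //.
  by apply/setP => x; rewrite !inE; apply/negbTE.
Qed.

Lemma sum_qeta : odd #|F| -> \sum_(x : F) qeta x = 0.
Proof.
move=> oddF; apply: (addrI (\sum_(x : F) 1)); rewrite -big_split addr0 /=.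
under eq_bigr do rewrite -card_square_roots //.
rewrite -(big_morph Posz PoszD (erefl _)) sumr_const -natz; congr _%:R.
rewrite -[RHS]sum1_card [RHS](partition_big (fun x => x ^+ 2) xpredT) //=.
by apply: eq_bigr => v _; rewrite sum1dep_card.
Qed.

(* For a non-square [x], no term of the sum over [y] of [qeta (x * y) + qeta y]
   is positive, while the sum vanishes. *)
Lemma qetaM : {morph @qeta F : x y / x * y}.
Proof.
move=> x y; case: (qetaP x) => [->|w w0 ->|x0 nosqrt].
- by rewrite !mul0r qeta0.
- by rewrite qeta_mul_sqr // mul1r.
have oddF : odd #|F|.
  apply: contraT => evenF; have /eqP[] := nosqrt (x ^+ #|F|./2).
  by rewrite -exprM muln2 even_halfK ?expf_card.
have qeta_x : qeta x = -1.
  case: qetaP => // [/eqP|w _ xE]; first by rewrite (negPf x0).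
  by have := nosqrt w; rewrite xE eqxx.
rewrite mulN1r; apply/eqP; rewrite -addr_eq0 -oppr_eq0; apply/eqP; move: y isT.
apply/(psumr_eq0P (P := xpredT)) => [y _|]; last first.
  rewrite sumrN big_split /= sum_qeta // addr0; apply/eqP; rewrite oppr_eq0.
  by have := sum_qeta oddF; rewrite (reindex_inj (mulfI x0)) => ->.
have [yx|w w0 ->|_ _] := qetaP y; first by rewrite yx mulr0 qeta0.
  by rewrite mulrC qeta_mul_sqr // qeta_x.
by case: qetaP.
Qed.

Lemma qeta1 : qeta (1 : F) = 1.
Proof. by rewrite -[1](expr1n _ 2) qeta_sqr ?oner_neq0. Qed.

Lemma qetaX x k : qeta (x ^+ k) = qeta x ^+ k.
Proof. by elim: k => [|k IH]; rewrite ?qeta1 // !exprS qetaM IH. Qed.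

Lemma qeta_signed_prod (I : finType) (f : I -> F) (y : int) k :
  \prod_i qeta (f i) * (qeta (-1 : F) * y) ^+ k
  = qeta ((-1) ^+ k * \prod_i f i) * y ^+ k.
Proof.
by rewrite qetaM qetaX (big_morph _ qetaM qeta1) exprMn mulrCA mulrA.
Qed.

(** * Power sums in the group ring *)

Definition qeta_elt : group_ring F := [ffun v => qeta v].

Lemma uniform_mul_qeta : odd #|F| -> uniform * qeta_elt = 0.
Proof.
move=> oddF; rewrite mul_uniform (_ : augmentation _ = 0) ?mul0r //.
by rewrite -[RHS](sum_qeta oddF); apply: eq_bigr => v _; rewrite ffunE.
Qed.

Lemma sum_dirac_linear u : u != 0 -> \sum_(x : F) dirac (u * x) = uniform.
Proof. by move=> u0; rewrite uniformE [RHS](reindex_inj (mulfI u0)). Qed.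

Lemma sum_dirac_square u : odd #|F| -> u != 0 ->
  \sum_(x : F) dirac (u * x ^+ 2) = uniform + (qeta u)%:~R * qeta_elt.
Proof.
move=> oddF u0; apply/ffunP => v.
rewrite sum_ffunE ffunE intr_group_ringE !ffunE.
rewrite -(qetaV u) -qetaM -card_square_roots //.
rewrite -sum1_card -natz natr_sum [RHS]big_mkcond.
apply: eq_bigr => x _; rewrite ffunE inE.
by rewrite -(inj_eq (mulfI u0) (x ^+ 2)) mulVKf // eq_sym; case: eqP.
Qed.

(* [x ^+ 2 - y ^+ 2] factors as the product of two independent variables. *)
Lemma sum_dirac_sub_squares : odd #|F| ->
  \sum_(x : F) \sum_(y : F) dirac (x ^+ 2 - y ^+ 2)
  = #|F|%:R + (#|F|.-1)%:R * uniform.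
Proof.
move=> /odd_card_two_neq0 two0.
transitivity (\sum_(w : F) \sum_(u : F) dirac (w * u)).
  under eq_bigr => x _ do rewrite (reindex_inj (subrI x)).
  rewrite exchange_big; apply: eq_bigr => w _ /=.
  rewrite [RHS](reindex_inj (inj_comp (addIr (- w)) (mulfI two0))).
  by apply: eq_bigr => x _ /=; congr dirac; ring.
rewrite (bigD1 0) //=; congr (_ + _).
  by under eq_bigr do rewrite mul0r; rewrite sumr_const.
rewrite mulr_natl -sumr_const_units; apply: eq_bigr => w w0.
exact: sum_dirac_linear.
Qed.

Lemma qeta_elt_sqr : odd #|F| ->
  qeta_elt ^+ 2 = (qeta (-1 : F))%:~R * (#|F|%:R - uniform).
Proof.
move=> oddF; have N1_neq0 : -1 != 0 :> F by rewrite oppr_eq0 oner_neq0.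
have : (uniform + qeta_elt) * (uniform + (qeta (-1 : F))%:~R * qeta_elt)
     = #|F|%:R + (#|F|.-1)%:R * uniform.
  rewrite -sum_dirac_sub_squares // -sum_dirac_square //.
  have <- : \sum_(x : F) dirac (1 * x ^+ 2) = uniform + qeta_elt.
    by rewrite sum_dirac_square ?oner_neq0 // qeta1 mul1r.
  rewrite mulr_suml; apply: eq_bigr => x _; rewrite mulr_sumr.
  by apply: eq_bigr => y _; rewrite mul1r mulN1r diracD.
rewrite mulrDl !mulrDr mul_uniform augmentation_uniform mulrz_nat.
rewrite natr_card_pred.
rewrite mulrCA [qeta_elt * uniform]mulrC uniform_mul_qeta // mulr0 addr0 add0r.
rewrite mulrCA -expr2; set e := (qeta _)%:~R => qeta_sqrE.
have e_sqr : e * e = 1 by rewrite -intrM qeta_mulss.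
rewrite -mulrDr -[LHS]mul1r -[in LHS]e_sqr -mulrA; congr (_ * _).
by apply: (addrI (#|F|%:R * uniform)); rewrite qeta_sqrE; ring.
Qed.

Lemma qeta_eltX_step k : odd #|F| ->
  qeta_elt ^+ k.+3 = (qeta (-1 : F) * #|F|%:R)%:~R * qeta_elt ^+ k.+1.
Proof.
move=> oddF; have -> : k.+3 = (k.+1 + 2)%N by rewrite addn2.
rewrite exprD qeta_elt_sqr // mulrCA mulrBr [_ * uniform]mulrC exprS.
by rewrite [uniform * _]mulrA uniform_mul_qeta // mul0r subr0; ring.
Qed.

Lemma qeta_eltX_coef0 k : (0 < k -> odd #|F|)%N ->
  #|F|%:R * (qeta_elt ^+ k) 0
  = if odd k then 0
    else (qeta (-1 : F) * #|F|%:R) ^+ k./2 * (#|F|%:R - 1) + (k == 0)%:R.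
Proof.
elim/ltn_ind: k => -[|[|[|k]]] IH oddF.
- by rewrite expr0 group_ring1 ffunE eqxx /=; ring.
- by rewrite expr1 ffunE qeta0 mulr0.
- rewrite qeta_elt_sqr ?oddF // intr_group_ringE.
  rewrite !ffunE group_ring1 group_ringMnE ffunE eqxx /= expr1 addr0.
  by rewrite mulrCA mulrA.
rewrite qeta_eltX_step ?oddF // intr_group_ringE mulrCA IH //.
by rewrite /= negbK; case: odd; rewrite ?mulr0 // !addr0 exprS mulrA.
Qed.

Definition power_sum c u (d : nat) : group_ring F :=
  c%:~R + \sum_(x | x != 0) dirac (u * x ^+ d).

Lemma power_sum_scale c u d s y : (d %| s)%N -> y != 0 ->
  power_sum c (y ^+ s * u) d = power_sum c u d.
Proof.
move=> /dvdnP[r ->] y0; have yr0 : y ^+ r != 0 by rewrite expf_neq0.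
congr (_ + _); rewrite [RHS](reindex_inj (mulfI yr0)) /=; apply: eq_big => x.
  by rewrite mulf_eq0 (negPf yr0).
by move=> _; rewrite exprMn exprM mulrCA mulrA.
Qed.

Lemma sum_power_sum_scale c u d s :
  \sum_(y | y != 0) power_sum c (y ^+ s * u) d
  = power_sum c u (gcdn d s) *+ #|F|.-1.
Proof.
rewrite big_split sumr_const_units mulrnDl /=; congr (_ + _).
rewrite -(sum_units_expr_gcd (fun z => dirac (u * z))) exchange_big.
by apply: eq_bigr => x _; apply: eq_bigr => y _; congr dirac; ring.
Qed.

Lemma power_sum_gcd c u d : power_sum c u d = power_sum c u (gcdn d #|F|.-1).
Proof.
apply: (group_ring_mulIn card_units_gt0).
rewrite -sum_power_sum_scale -sumr_const_units; apply: eq_bigr => y y0.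
by rewrite expf_card_pred ?mul1r.
Qed.

Lemma power_sum_weighted c u d : (0 < d)%N ->
  power_sum c u d = \sum_x (if x == 0 then c else 1)%:~R * dirac (u * x ^+ d).
Proof.
move=> d_gt0; rewrite (bigD1 0) //= eqxx expr0n gtn_eqF // !mulr0 mulr1.
by congr (_ + _); apply: eq_bigr => x /negPf ->; rewrite mul1r.
Qed.

Lemma power_sum_shift c u d : (0 < d)%N ->
  power_sum c u d = (c - 1)%:~R + \sum_x dirac (u * x ^+ d).
Proof.
move=> d_gt0; rewrite [X in _ + X](bigD1 0) //= expr0n gtn_eqF // mulr0.
by rewrite addrA intrB subrK.
Qed.

Lemma power_sum_linear c u : u != 0 ->
  power_sum c u 1 = uniform + (c - 1)%:~R.
Proof. by move=> u0; rewrite power_sum_shift // addrC sum_dirac_linear. Qed.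

Lemma power_sum_quadratic c u : odd #|F| -> u != 0 ->
  power_sum c u 2 = uniform + ((qeta u)%:~R * qeta_elt + (c - 1)%:~R).
Proof.
by move=> oddF u0; rewrite power_sum_shift // sum_dirac_square // addrC addrA.
Qed.

(** * Zeros of diagonal forms *)

Section DiagonalForm.
Variable I : finType.
Implicit Types (m d s : I -> nat).

Definition diag_form (a : I -> F) m (x : {ffun I -> F}) : F :=
  \sum_i a i * x i ^+ m i.

Definition diag_zeros c (a : I -> F) m : int :=
  \sum_(x : {ffun I -> F} | diag_form a m x == 0) c ^+ #|[set i | x i == 0]|.

Lemma eq_diag_zeros c a m d : m =1 d -> diag_zeros c a m = diag_zeros c a d.
Proof.
move=> md; apply: eq_bigl => x; congr (_ == _).
by apply: eq_bigr => i _; rewrite md.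
Qed.

Lemma diag_zerosE c a m : (forall i, 0 < m i)%N ->
  diag_zeros c a m = (\prod_i power_sum c (a i) (m i)) 0.
Proof.
move=> m_gt0; under [in RHS]eq_bigr do rewrite power_sum_weighted //.
rewrite bigA_distr_bigA sum_ffunE [LHS]big_mkcond; apply: eq_bigr => x _ /=.
rewrite big_split -dirac_sum -rmorph_prod intr_group_ringE ffunE /=.
rewrite -big_mkcond prodr_const eq_sym -/(diag_form a m x) cardsE.
by case: eqP; rewrite (mulr1, mulr0).
Qed.

Lemma diag_zeros_scale c b a m : b != 0 ->
  diag_zeros c (fun i => b * a i) m = diag_zeros c a m.
Proof.
move=> b0; apply: eq_bigl => x; rewrite /diag_form.
by under eq_bigr do rewrite -mulrA; rewrite -mulr_sumr mulf_eq0 (negPf b0).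
Qed.

Lemma diag_zeros_gcd_pred c a m : (forall i, 0 < m i)%N ->
  diag_zeros c a m = diag_zeros c a (fun i => gcdn (m i) #|F|.-1).
Proof.
move=> m_gt0; rewrite !diag_zerosE // => [|i]; last by rewrite gcdn_gt0 m_gt0.
by congr (fun_of_fin _ 0); apply: eq_bigr => i _; exact: power_sum_gcd.
Qed.

Lemma diag_zeros_gcd c a d s : (forall i, 0 < d i)%N ->
  (forall i j, i != j -> d i %| s j)%N ->
  diag_zeros c a d = diag_zeros c a (fun i => gcdn (d i) (s i)).
Proof.
move=> d_gt0 ds.
have gcd_gt0 i : (0 < gcdn (d i) (s i))%N by rewrite gcdn_gt0 d_gt0.
apply: (@pmulrnI _ (#|F|.-1 ^ #|I|)%N).
  by rewrite expn_gt0 card_units_gt0.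
transitivity
  (\sum_(y : {ffun I -> F} | y \in ffun_on (predC1 0)) diag_zeros c a d).
  by rewrite sumr_const card_ffun_on cardC1.
have -> : (#|F|.-1 ^ #|I| = \prod_(i : I) #|F|.-1)%N.
  by rewrite prod_nat_const.
rewrite [in RHS]diag_zerosE // -group_ringMnE -prodrMn.
under [in RHS]eq_bigr do rewrite -sum_power_sum_scale.
rewrite bigA_distr_big sum_ffunE; apply: eq_bigr => y /ffun_onP units_y.
have y0 j : y j != 0 := units_y j.
have ys0 : \prod_j y j ^+ s j != 0.
  by apply/prodf_neq0 => j _; rewrite expf_neq0.
rewrite -(diag_zeros_scale _ _ _ ys0) diag_zerosE //; congr (fun_of_fin _ 0).
apply: eq_bigr => i _; rewrite (bigD1 i) //= mulrAC mulrC.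
elim/big_rec: _ => [|j z ji IH]; first by rewrite mul1r.
by rewrite -mulrA power_sum_scale // ds // eq_sym.
Qed.

Lemma prod_affine_qeta_coef0 c (P : {pred I}) (f : I -> int) :
  (forall i, i \in P -> odd #|F|) ->
  #|F|%:R * (\prod_i ((if i \in P then f i else 0)%:~R * qeta_elt + c%:~R)) 0
  = (#|F|%:R - 1) * even_esym P f c (qeta (-1 : F) * #|F|%:R) + c ^+ #|I|.
Proof.
move=> oddF; rewrite prod_affine sum_ffunE /even_esym !mulr_sumr.
have <- : \sum_(J : {set I} | J == set0) c ^+ #|~: J| = c ^+ #|I|.
  by rewrite big_pred1_eq setC0 cardsT.
rewrite [in RHS]big_mkcond [X in _ = _ + X]big_mkcond -big_split.
apply: eq_bigr => J _ /=.
have [JP|/subsetPn[i iJ iP]] := boolP (J \subset P); last first.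
  rewrite (bigD1 i) //= (negPf iP) mul0r mulr0 mul0r ffunE mulr0 add0r.
  by case: eqP iJ => // ->; rewrite inE.
have -> : \prod_(i in J) (if i \in P then f i else 0)%:~R
    = (\prod_(i in J) f i)%:~R :> group_ring F.
  by rewrite rmorph_prod; apply: eq_bigr => i /(subsetP JP) ->.
rewrite -rmorphXn -rmorphM intr_group_ringE mulrCA qeta_eltX_coef0; last first.
  by case/card_gt0P => i /(subsetP JP); apply: oddF.
have [->|J0] := eqVneq J set0; first by rewrite cards0 big_set0 /=; ring.
rewrite cards_eq0 (negPf J0) /= !addr0; case: odd => /=; first by rewrite mulr0.
by ring.
Qed.

Lemma diag_zeros_linear_quadratic c a (P : {pred I}) :
  (forall i, a i != 0) -> (forall i, i \in P -> odd #|F|) ->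
  #|F|%:R * diag_zeros c a (fun i => if i \in P then 2%N else 1%N)
  = (#|F|%:R + c - 1) ^+ #|I|
    + (#|F|%:R - 1)
      * even_esym P (fun i => qeta (a i)) (c - 1) (qeta (-1 : F) * #|F|%:R).
Proof.
move=> a_neq0 oddF; rewrite diag_zerosE => [|i]; last by case: ifP.
pose f i : group_ring F :=
  (if i \in P then qeta (a i) else 0)%:~R * qeta_elt + (c - 1)%:~R.
have power_sumD i :
    power_sum c (a i) (if i \in P then 2 else 1) = uniform + f i.
  rewrite /f; case: ifP => [iP|_]; last by rewrite mul0r add0r power_sum_linear.
  by rewrite power_sum_quadratic // (oddF i).
have uniform_f i : uniform * f i = (c - 1)%:~R * uniform.
  rewrite mulrDr mulrCA [uniform * _%:~R]mulrC; case: ifP => [iP|_].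
    by rewrite uniform_mul_qeta ?(oddF i) // mulr0 add0r.
  by rewrite mul0r add0r.
rewrite (eq_bigr _ (fun i _ => power_sumD i)) -natr_group_ringE.
rewrite (prod_uniformD _ uniform_f) ffunE natr_group_ringE intr_group_ringE.
rewrite prod_affine_qeta_coef0 // ffunE mulr1.
have prod_const (z : int) : \prod_(i : I) z = z ^+ #|I| by rewrite prodr_const.
by rewrite !prod_const -[_ + c - 1]addrA; ring.
Qed.

Definition torus : {set {ffun I -> F}} :=
  [set x : {ffun I -> F} | [forall i, x i != 0]].

Lemma card_torus : #|torus| = (#|F|.-1 ^ #|I|)%N.
Proof.
rewrite -(cardC1 (0 : F)) -card_ffun_on; apply: eq_card => x.
by rewrite inE; apply/forallP/ffun_onP.
Qed.

Lemma diag_zeros1 a m :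
  diag_zeros 1 a m = #|[set x | diag_form a m x == 0]|%:R.
Proof.
rewrite /diag_zeros -sum1_card natr_sum; apply: eq_big => [x|x _].
  by rewrite inE.
by rewrite expr1n.
Qed.

Lemma diag_zeros0 a m :
  diag_zeros 0 a m = #|[set x in torus | diag_form a m x == 0]|%:R.
Proof.
rewrite /diag_zeros -sum1dep_card natr_sum [LHS]big_mkcond [RHS]big_mkcond /=.
apply: eq_bigr => x _; rewrite expr0n cards_eq0 andbC inE; case: eqP => //= _.
suff -> : ([set i | x i == 0] == set0) = [forall i, x i != 0] by case: ifP.
apply/eqP/forallP => [zeros0 i|x0].
  by have := in_set0 i; rewrite -zeros0 inE => ->.
by apply/setP => i; rewrite !inE; apply/negbTE.
Qed.

Lemma diag_zeros_coprime c a d :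
  (forall i, 0 < d i)%N ->
  (forall i j, i != j -> coprime (odd_or_half (d i)) (odd_or_half (d j))) ->
  diag_zeros c a d = diag_zeros c a (fun i => if odd (d i) then 1 else 2)%N.
Proof.
move=> d_gt0 half_coprime.
pose s i := (2 * \prod_(j | j != i) odd_or_half (d j))%N.
have gcd_s i : gcdn (d i) (s i) = (if odd (d i) then 1 else 2)%N.
  rewrite gcdn_double //; elim/big_rec: _ => [|j e ji IH].
    exact: coprimen1.
  by rewrite coprimeMr IH half_coprime // eq_sym.
rewrite (diag_zeros_gcd _ _ (s := s)) // => [|i j ij]; last first.
  rewrite {1}[d i]odd_or_halfE /s (bigD1 i) //= dvdn_mul ?dvdn_mulr //.
  by case: odd.
by apply: eq_diag_zeros => i; rewrite gcd_s.
Qed.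

Lemma diag_zeros_formula c a m (P : {pred I}) :
  (forall i, a i != 0) -> (forall i, 0 < m i)%N ->
  (forall i, (i \in P) = ~~ odd (gcdn (m i) #|F|.-1)) ->
  (forall i j, i != j -> coprime (odd_or_half (gcdn (m i) #|F|.-1))
                                 (odd_or_half (gcdn (m j) #|F|.-1))) ->
  #|F|%:R * diag_zeros c a m
  = (#|F|%:R + c - 1) ^+ #|I|
    + (#|F|%:R - 1)
      * even_esym P (fun i => qeta (a i)) (c - 1) (qeta (-1 : F) * #|F|%:R).
Proof.
move=> a_neq0 m_gt0 mem_evenE half_coprime; rewrite diag_zeros_gcd_pred //.
rewrite diag_zeros_coprime // => [|i]; last by rewrite gcdn_gt0 m_gt0.
rewrite -(@diag_zeros_linear_quadratic c a P) // => [|i]; last first.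
  by rewrite mem_evenE; apply: even_gcd_odd_card.
by congr (_ * _); apply: eq_diag_zeros => i; rewrite mem_evenE; case: odd.
Qed.

End DiagonalForm.

(** * Orbits of the multiplicative group *)

Lemma exprz_coprime_inv (e : int) : gcdz e #|F|.-1%:Z = 1 ->
  exists u : int, forall x y, x != 0 -> y != 0 -> (x ^ e == y) = (x == y ^ u).
Proof.
have [u [v bezout]] := Bezoutz e #|F|.-1%:Z => gcd1; exists u => x y x0 y0.
have expK (z : F) : z != 0 -> z ^ (u * e) = z.
  move=> z0; transitivity (z ^ (u * e + v * #|F|.-1%:Z)).
    rewrite expfzDr // [v * _]mulrC -(exprz_exp _ _ v) -exprnP.
    by rewrite expf_card_pred // exp1rz mulr1.
  by rewrite bezout gcd1 expr1z.
by apply/eqP/eqP => [<-|->]; rewrite exprz_exp ?[e * u]mulrC expK.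
Qed.

End FiniteField.

Section UnitAction.
Variables (F : finFieldType) (T : finType) (X : {set T}) (act : F -> T -> T).
Variables (f g : T -> F) (r s : nat).
Hypothesis act_inj : forall c, c != 0 -> injective (act c).
Hypothesis actX : forall c x, c != 0 -> (act c x \in X) = (x \in X).
Hypothesis f_act : forall c x, c != 0 -> f (act c x) = c ^+ r * f x.
Hypothesis g_act : forall c x, c != 0 -> g (act c x) = c ^+ s * g x.
Hypothesis g_neq0 : {in X, forall x, g x != 0}.
Hypothesis coprime_weights : gcdz (s%:Z - r%:Z) #|F|.-1%:Z = 1.

(* The ratio [g / f] is multiplied by [c ^ (s - r)] under the action of [c], so
   each orbit meets the locus [f = g] for exactly one [c]. *)
Lemma card_homogeneous_eq :
  (#|F|.-1 * #|[set x in X | f x == g x]| = #|[set x in X | f x != 0%R]|)%N.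
Proof.
have [u expr_weights] := exprz_coprime_inv coprime_weights.
transitivity
  (\sum_(c in predC1 (0%R : F)) \sum_(x in X) (f (act c x) == g (act c x)))%N.
  rewrite -(cardC1 (0 : F)) -sum_nat_const; apply: eq_bigr => c c0.
  rewrite -sum1dep_card big_mkcondr (reindex_inj (act_inj c0)) /=.
  by apply: eq_big => x; [rewrite actX | case: eqP].
rewrite exchange_big -sum1dep_card [RHS]big_mkcondr; apply: eq_bigr => x xX /=.
have [fx0|fx0] := eqVneq (f x) 0.
  rewrite big1 // => c c0; rewrite f_act // g_act // fx0 mulr0 eq_sym.
  by rewrite mulf_eq0 expf_eq0 (negPf (c0 : c != 0)) (negPf (g_neq0 xX)) andbF.
have ratio0 : f x / g x != 0 by rewrite mulf_neq0 // invr_eq0 g_neq0.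
have meetE c : c != 0 -> (f (act c x) == g (act c x)) = (c == (f x / g x) ^ u).
  move=> c0; rewrite -expr_weights // f_act // g_act // expfzDr //.
  rewrite -exprnP -exprnN eqr_div ?expf_neq0 ?g_neq0 //.
  by rewrite eq_sym [f x * _]mulrC.
rewrite (bigD1 ((f x / g x) ^ u : F)) /=; last by rewrite !inE expfz_neq0.
rewrite meetE ?expfz_neq0 // eqxx big1 // => c /andP[c0 /negPf c_neq].
by rewrite meetE // c_neq.
Qed.

End UnitAction.

(** * Solutions of the monomial equation *)

Section MonomialEquation.
Variables (F : finFieldType) (I : finType) (a : I -> F) (b : F).
Variables (m e : I -> nat) (k M : nat).
Hypotheses (a_neq0 : forall i, a i != 0) (b_neq0 : b != 0).
Hypotheses (m_gt0 : forall i, (0 < m i)%N) (k_gt0 : (0 < k)%N).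
Hypothesis e_gt0 : forall i, (0 < e i)%N.
Hypothesis m_dvd : forall i, (m i %| M)%N.
Hypothesis coprime_weights :
  gcdz (\sum_i (e i * (M %/ m i))%N%:Z - (k * M)%N%:Z) #|F|.-1%:Z = 1.

Definition monomial_eq (x : {ffun I -> F}) :=
  diag_form a m x ^+ k == b * \prod_i x i ^+ e i.

Definition weighted_scale (c : F) (x : {ffun I -> F}) : {ffun I -> F} :=
  [ffun i => c ^+ (M %/ m i) * x i].

Lemma weighted_scale_inj c : c != 0 -> injective (weighted_scale c).
Proof.
move=> c0 x y /ffunP xy; apply/ffunP => i; have := xy i; rewrite !ffunE.
by apply: mulfI; rewrite expf_neq0.
Qed.

Lemma weighted_scale_torus c x :
  c != 0 -> (weighted_scale c x \in torus F I) = (x \in torus F I).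
Proof.
move=> c0; rewrite !inE; apply: eq_forallb => i.
by rewrite ffunE mulf_eq0 expf_eq0 (negPf c0) andbF.
Qed.

Lemma diag_form_weighted_scale c x :
  diag_form a m (weighted_scale c x) = c ^+ M * diag_form a m x.
Proof.
rewrite mulr_sumr; apply: eq_bigr => i _.
by rewrite ffunE exprMn -exprM divnK // mulrCA.
Qed.

Lemma monomial_weighted_scale c x :
  \prod_i weighted_scale c x i ^+ e i
  = c ^+ (\sum_i e i * (M %/ m i)) * \prod_i x i ^+ e i.
Proof.
rewrite expr_sum -big_split; apply: eq_bigr => i _.
by rewrite ffunE exprMn -exprM mulnC.
Qed.

Lemma card_monomial_eq_torus :
  (#|F|.-1 * #|[set x in torus F I | monomial_eq x]|
   + #|[set x in torus F I | diag_form a m x == 0%R]| = #|F|.-1 ^ #|I|)%N.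
Proof.
rewrite -card_torus -[RHS](cardsID [set x | diag_form a m x == 0]) addnC.
rewrite setIdE; congr (_ + _)%N.
transitivity #|[set x in torus F I | diag_form a m x ^+ k != 0]|; last first.
  by apply: eq_card => x; rewrite !inE expf_eq0 k_gt0 andbC.
apply: (card_homogeneous_eq weighted_scale_inj weighted_scale_torus
  (r := M * k) (s := \sum_i e i * (M %/ m i))) => [c x _|c x _|x|].
- by rewrite diag_form_weighted_scale exprMn -exprM.
- by rewrite monomial_weighted_scale mulrCA.
- rewrite inE => /forallP x0; rewrite mulf_neq0 //.
  by apply/prodf_neq0 => i _; rewrite expf_neq0.
by rewrite mulnC (big_morph Posz PoszD (erefl _)).
Qed.

Lemma card_monomial_eq_split :
  (#|[set x | monomial_eq x]|
     + #|[set x in torus F I | diag_form a m x == 0%R]|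
   = #|[set x | diag_form a m x == 0%R]|
     + #|[set x in torus F I | monomial_eq x]|)%N.
Proof.
rewrite -(cardsID (torus F I) [set x | monomial_eq x]).
rewrite -(cardsID (torus F I) [set x | diag_form a m x == 0]).
have -> : [set x | monomial_eq x] :\: torus F I
    = [set x | diag_form a m x == 0] :\: torus F I.
  apply/setP => x; rewrite !inE negb_forall.
  case: existsP => //= -[i]; rewrite negbK => /eqP xi0.
  rewrite /monomial_eq (bigD1 i) //= xi0 expr0n gtn_eqF //.
  by rewrite mul0r mulr0 expf_eq0 k_gt0.
by rewrite !setIdE ![_ :&: torus F I]setIC addnC addnCA addnC.
Qed.

Lemma card_monomial_eq (P : {pred I}) :
  (forall i, (i \in P) = ~~ odd (gcdn (m i) #|F|.-1)) ->
  (forall i j, i != j -> coprime (odd_or_half (gcdn (m i) #|F|.-1))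
                                 (odd_or_half (gcdn (m j) #|F|.-1))) ->
  let esym c :=
    even_esym P (fun i => qeta (a i)) c (qeta (-1 : F) * #|F|%:R) in
  #|F|%:R * #|[set x | monomial_eq x]|%:R
  = #|F|%:R ^+ #|I| + (#|F|%:R - 1) * esym 0 - #|F|%:R * esym (-1).
Proof.
move=> mem_evenE half_coprime esym; set q : int := #|F|%:R.
have zeros c : q * diag_zeros c a m
    = (q + c - 1) ^+ #|I| + (q - 1) * esym (c - 1) by exact: diag_zeros_formula.
have := zeros 0; rewrite diag_zeros0 addr0 sub0r.
have := zeros 1; rewrite diag_zeros1 addrK subrr.
have := congr1 (fun n => n%:R : int) card_monomial_eq_split.
have := congr1 (fun n => n%:R : int) card_monomial_eq_torus.
rewrite !natrD natrM natrX natr_card_pred -/q.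
set N := (#|[set x | monomial_eq x]|)%:R.
set N_torus := (#|[set x in _ | monomial_eq x]|)%:R.
set Z := (#|[set x | diag_form a m x == 0]|)%:R.
set Z_torus := (#|[set x in _ | diag_form a m x == 0]|)%:R.
move=> torusE splitE zerosE zeros_torusE.
have q1_neq0 : q - 1 != 0.
  by rewrite -natr_card_pred pnatr_eq0 -lt0n card_units_gt0.
apply: (mulfI q1_neq0); have -> : N = Z + N_torus - Z_torus.
  by rewrite -splitE addrK.
transitivity ((q - 1) * (q * Z) + q * ((q - 1) * N_torus + Z_torus)
              - q * (q * Z_torus)); first by ring.
by rewrite torusE zerosE zeros_torusE; ring.
Qed.

End MonomialEquation.

Lemma card_ord_geq n t : #|[pred i : 'I_n | (t <= i)%N]| = (n - t)%N.
Proof.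
rewrite -sum1_card -(big_geq_mkord t n xpredT (fun=> 1%N)).
by rewrite sum_nat_const_nat muln1.
Qed.

Lemma subset_ord_geq n t :
  (0 < n)%N -> ([set: 'I_n] \subset [pred i : 'I_n | (t <= i)%N]) = (t == 0%N).
Proof.
move=> n_gt0; apply/subsetP/eqP => [/(_ (Ordinal n_gt0) (in_setT _))|-> //].
by rewrite inE leqn0 => /eqP.
Qed.

Theorem theorem4 (F : finFieldType) (n : nat) (a : 'I_n -> F) (b : F)
    (m kk : 'I_n -> nat) (k t : nat) :
  (2 <= n)%N ->
  (forall j, a j != 0) -> b != 0 ->
  (forall j, 0 < m j)%N -> (0 < k)%N -> (forall j, 0 < kk j)%N ->
  let q := #|F| in
  let M := \big[lcmn/1%N]_(j < n) m j in
  let d := fun j : 'I_n => gcdn (m j) q.-1 in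
  (t <= n)%N ->
  (forall j : 'I_n, (j < t)%N -> odd (d j)) ->
  (forall j : 'I_n, (t <= j)%N -> ~~ odd (d j)) ->
  (forall i j : 'I_n, i != j ->
     coprime (if (i < t)%N then d i else (d i)./2)
             (if (j < t)%N then d j else (d j)./2)) ->
  gcdz (\sum_(j < n) ((kk j * (M %/ m j))%N)%:Z - ((k * M)%N)%:Z) (q.-1)%:Z = 1 ->
  (#|[set x : {ffun 'I_n -> F} |
        (\sum_(j < n) a j * x j ^+ m j) ^+ k == b * \prod_(j < n) x j ^+ kk j]|%:Z
   = (q%:Z) ^+ n.-1 + (-1) ^+ n.-1
     + (-1) ^+ n.-1 *
       \sum_(1 <= j < ((n - t)./2).+1)
          qeta ((-1) ^+ j : F)
          * esym_at [pred i : 'I_n | (t <= i)%N] (fun i => qeta (a i)) (2 * j)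
          * (q%:Z) ^+ j
     + (if (t == 0%N) && ~~ odd n then
          qeta ((-1) ^+ (n./2) * \prod_(j < n) a j) * (q%:Z) ^+ (n - 2)./2 * (q%:Z - 1)
        else 0)).
Proof.
move=> n_ge2 a_neq0 b_neq0 m_gt0 k_gt0 kk_gt0 q M d _ d_odd d_even.
move=> d_coprime weights_coprime.
have n_gt0 : (0 < n)%N := ltnW n_ge2.
have even_dE (i : 'I_n) : (i \in [pred i : 'I_n | t <= i]%N) = ~~ odd (d i).
  by rewrite inE; case: leqP => [/d_even|/d_odd] ->.
have halfE i : odd_or_half (d i) = if (i < t)%N then d i else (d i)./2.
  by rewrite /odd_or_half; case: ltnP => [/d_odd|/d_even/negPf] ->.
have half_coprime i j : i != j ->
    coprime (odd_or_half (d i)) (odd_or_half (d j)).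
  by rewrite !halfE; apply: d_coprime.
have m_dvd_M j : (m j %| M)%N by apply: (biglcmn_sup j).
have q_neq0 : q%:R != 0 :> int by rewrite pnatr_eq0 -lt0n ltnW ?finNzRing_gt1.
apply: (mulfI q_neq0); rewrite -[Posz #|_|]natz -[Posz q]natz.
rewrite (card_monomial_eq a_neq0 b_neq0 m_gt0 k_gt0 kk_gt0 m_dvd_M
  weights_coprime even_dE half_coprime) even_esym0 even_esymN1.
rewrite card_ord_geq card_ord subset_ord_geq // qeta_signed_prod -/q.
under [in RHS]eq_bigr do rewrite qetaX mulrAC -exprMn mulrC.
have expr_n (z : int) : z ^+ n = z * z ^+ n.-1 by rewrite -exprS prednK.
have -> : q%:R ^+ n./2 = q%:R * q%:R ^+ (n - 2)./2 :> int.
  by rewrite -exprS -[in LHS](subnK n_ge2) addn2.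
by rewrite !expr_n; case: ifP => _; ring.
Qed.
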